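(* There is a measurable colouring of $\mathbb{R}^2$ with $49$ colours (a partition into $49$ measurable sets) such that, for every colour class $C$, the set $$\{\operatorname{tr}(A_{\mathbf v}):\mathbf v=(v_0,v_1,v_2)\in C^3\text{ and }v_0,v_1,v_2\text{ are affinely independent}\}$$ is not all of $\mathbb{R}$. Consequently, for every $d\geq 2$, there is a finite measurable colouring of $\mathbb{R}^d$ for which no colour class realizes all values of $c_1(A_{\mathbf v})$; that is, for no colour class $C$ is $\{c_1(A_{\mathbf v}):\mathbf v=(v_0,\ldots,v_d)\in C^{d+1}\}$ equal to $\mathbb{R}$.
   Context: For an ordered tuple $\mathbf v=(v_0,\ldots,v_d)$ of vectors in $\mathbb{R}^d$, the edge matrix $A_{\mathbf v}=[\,v_1-v_0\ \cdots\ v_d-v_0\,]$ is the $d\times d$ matrix with columns $v_j-v_0$, and $c_1(A)=\operatorname{tr}(A)$ is the ordinary trace. *)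

(* Defs.v *)
(* MathComp-Analysis; R^d is the type 'cV[R]_d of column vectors. *)
From HB Require Import structures.
From mathcomp Require Import all_boot all_order all_algebra.
From mathcomp Require Import all_classical all_reals all_analysis.

Set Implicit Arguments.
Unset Strict Implicit.
Unset Printing Implicit Defensive.

Import Order.TTheory GRing.Theory Num.Theory.
Local Open Scope classical_set_scope.
Local Open Scope ring_scope.

(* Column j (0-based) is v_{j+1} - v_0: [lift ord0] is the successor
   'I_d -> 'I_d.+1. *)
Definition edge_matrix (R : realType) (d : nat) (v : 'I_d.+1 -> 'cV[R]_d) :
    'M[R]_d :=
  \matrix_(i, j) (v (lift ord0 j) - v ord0) i 0.

Definition affinely_independent (R : realType) (d m : nat)
    (v : 'I_m -> 'cV[R]_d) : Prop :=
  forall a : 'I_m -> R,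
    \sum_i a i = 0 -> \sum_i a i *: v i = 0 -> forall i, a i = 0.

Definition box (R : realType) (d : nat) (a b : 'cV[R]_d) : set 'cV[R]_d :=
  [set x | forall i, a i 0 <= x i 0 <= b i 0].

(* The truncation at 0 gives volume 0 to the empty box (for d > 0). *)
Definition box_volume (R : realType) (d : nat) (a b : 'cV[R]_d) : R :=
  \prod_(i < d) Num.max 0 (b i 0 - a i 0).

(* Meaningful for d > 0 only: in dimension 0 every box has volume 1, so every
   countably infinite cover has infinite total volume. *)
Definition lebesgue_outer (R : realType) (d : nat) (X : set 'cV[R]_d) :
    \bar R :=
  ereal_inf [set (\sum_(0 <= k <oo) (box_volume (ab k).1 (ab k).2)%:E)%E
            | ab in [set ab : nat -> 'cV[R]_d * 'cV[R]_d
                    | X `<=` \bigcup_k box (ab k).1 (ab k).2]].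

Definition lebesgue_measurable (R : realType) (d : nat) (A : set 'cV[R]_d) :
    Prop :=
  caratheodory_measurable (@lebesgue_outer R d) A.

(* The library's [partition] also asks that every class be nonempty, so that
   exactly n colours are used. *)
Definition measurable_colouring (R : realType) (d n : nat)
    (C : 'I_n -> set 'cV[R]_d) : Prop :=
  partition setT C setT /\ forall k, lebesgue_measurable (C k).

(* Main.v *)
Require Import Defs.
From HB Require Import structures.
From mathcomp Require Import all_boot all_order all_algebra.
From mathcomp Require Import all_classical all_reals all_analysis.
From mathcomp Require Import lra zify.

Set Implicit Arguments.
Unset Strict Implicit.
Unset Printing Implicit Defensive.

Import Order.TTheory GRing.Theory Num.Theory. 
Import numFieldNormedType.Exports.
Local Open Scope classical_set_scope.
Local Open Scope ring_scope.

(** Since tr A_v = \sum_i (v_{i+1} - v_0)_i, the i-th edge contributes only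
    its i-th coordinate.  Colour x by the residues modulo m of the integer
    parts of all its coordinates, which uses m ^ d colours.  If all v_j have
    the same colour, then every (v_{i+1} - v_0)_i lies within distance less
    than 1 of a multiple of m, so the trace lies within distance less than d of
    a multiple of m.  As soon as 2 d <= m the value d is at distance at least d
    from every multiple of m, hence is never attained
    ([trace_edge_matrix_neq]).  For d = 2 the choice m = 7 gives 49 colours; in
    dimension d, m = 2 d works.

    The colour classes are obtained from coordinate half-spaces by countable
    unions, differences and finite intersections
    ([residue_cell_measurable]).  So measurability reduces to two facts: the
    infimum of the total volumes of covers by closed boxes is an outer measure
    ([lebesgue_outer_sigma_subadditive]), and half-spaces satisfy the
    Caratheodory condition for it ([halfspace_measurable]), because a
    hyperplane orthogonal to an axis cuts a box into two boxes whose volumes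
    add up ([box_volume_split]). *)

(** * The outer measure defined by covers by boxes *)

Lemma box_volume_ge0 (R : realType) (d : nat) (a b : 'cV[R]_d) :
  0 <= box_volume a b.
Proof. by apply: prodr_ge0 => i _; rewrite le_max lexx. Qed.

Lemma lebesgue_outer_ge0 (R : realType) (d : nat) (X : set 'cV[R]_d) :
  (0 <= lebesgue_outer X)%E.
Proof.
apply: le_ereal_inf_tmp => _ [ab _ <-].
by apply: nneseries_ge0 => k _ _; rewrite lee_fin box_volume_ge0.
Qed.

Lemma lebesgue_outer_le (R : realType) (d : nat) :
  {homo @lebesgue_outer R d : A B / A `<=` B >-> (A <= B)%E}.
Proof.
move=> A B AB; apply/ereal_inf_le_tmp => _ [ab Bab <-]; exists ab => //.
exact: subset_trans AB Bab.
Qed.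

(** In positive dimension a one-point box has volume 0, so that the constant
    sequence of such boxes covers the empty set at no cost. *)
Lemma lebesgue_outer0 (R : realType) (d : nat) :
  @lebesgue_outer R d.+1 set0 = 0%E.
Proof.
apply/eqP; rewrite eq_le lebesgue_outer_ge0 andbT.
apply: ereal_inf_lbound; exists (fun=> (0, 0)) => //=.
apply: eseries0 => k _ _; congr EFin.
by rewrite /box_volume big_ord_recl subrr maxxx mul0r.
Qed.

Lemma lebesgue_outer_cover (R : realType) (d : nat) (X : set 'cV[R]_d) (e : R) :
  lebesgue_outer X <> +oo%E -> 0 < e ->
  exists2 ab : nat -> 'cV[R]_d * 'cV[R]_d,
    X `<=` \bigcup_k box (ab k).1 (ab k).2 &
    (\sum_(0 <= k <oo) (box_volume (ab k).1 (ab k).2)%:E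
      <= lebesgue_outer X + e%:E)%E.
Proof.
move=> Xoo e0.
have Xfin : lebesgue_outer X \is a fin_num.
  by rewrite ge0_fin_numE ?lebesgue_outer_ge0// ltey; apply/eqP.
have [_ [ab Xab <-] lt_ab] := lb_ereal_inf_adherent e0 Xfin.
by exists ab => //; exact: ltW.
Qed.

(** Cover F n up to e / 2 ^ (n + 1), then list all the boxes used in one
    sequence along a bijection f between nat and nat * nat; the total volume
    does not depend on the order of summation. *)
Lemma lebesgue_outer_sigma_subadditive (R : realType) (d : nat) :
  sigma_subadditive (@lebesgue_outer R d).
Proof.
move=> F.
have [[i ioo]|Foo] := pselect (exists i, lebesgue_outer (F i) = +oo%E).
  rewrite (eseries_pinfty _ _ ioo) ?leey// => n _.
  by rewrite -ltNye (lt_le_trans _ (lebesgue_outer_ge0 _)).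
apply/lee_addgt0Pr => e e0.
apply: le_trans (epsilon_trick _ (fun n => lebesgue_outer_ge0 _) (ltW e0)).
have /choice[G PG] n : exists ab : nat -> 'cV[R]_d * 'cV[R]_d,
    F n `<=` \bigcup_k box (ab k).1 (ab k).2 /\
    (\sum_(0 <= k <oo) (box_volume (ab k).1 (ab k).2)%:E
      <= lebesgue_outer (F n) + (e / (2 ^ n.+1)%:R)%:E)%E.
  have e2 : 0 < e / (2 ^ n.+1)%:R by rewrite divr_gt0// ltr0n expn_gt0.
  have [|ab] := @lebesgue_outer_cover _ _ (F n) _ _ e2; last by exists ab.
  by move=> Fn; apply: Foo; exists n.
pose vol i j : \bar R := (box_volume (G i j).1 (G i j).2)%:E.
have vol_ge0 i j : (0 <= vol i j)%E by rewrite lee_fin box_volume_ge0.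
have /card_esym/pcard_eqP/bijPex[f fbij] := card_nat2.
have [_ _ fsurj] := fbij.
apply: (@le_trans _ _ (\sum_(0 <= k <oo) vol (f k).1 (f k).2)%E).
  apply: ereal_inf_lbound; exists (fun k => G (f k).1 (f k).2) => //.
  move=> x [i _ Fix].
  have [j _ Gx] := (PG i).1 x Fix.
  have [k _ fk] := fsurj (i, j) I.
  by exists k => //=; rewrite fk.
rewrite nneseries_esumT//.
rewrite -(@reindex_esum _ _ _ _ _ f (fun ij => vol ij.1 ij.2) fbij).
have -> : [set: nat * nat] = [set: nat] `*`` (fun=> [set: nat]).
  by apply/seteqP; split.
rewrite -esum_esum// -nneseries_esumT; last by move=> i; exact: esum_ge0.
apply: lee_nneseries => [i *|i _]; first exact: esum_ge0.
by rewrite -nneseries_esumT//; exact: (PG i).2.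
Qed.

HB.instance Definition _ (R : realType) (d : nat) :=
  isOuterMeasure.Build R 'cV[R]_d.+1 (@lebesgue_outer R d.+1)
    (@lebesgue_outer0 R d) (@lebesgue_outer_ge0 R d.+1)
    (@lebesgue_outer_le R d.+1) (@lebesgue_outer_sigma_subadditive R d.+1).

(** * Measurability of half-spaces *)

Definition set_coord (R : realType) (d : nat) (i : 'I_d) (t : R)
    (x : 'cV[R]_d) : 'cV[R]_d :=
  \col_j if j == i then t else x j 0.

(** The identity also holds for an empty box and for t outside the box: the
    truncation at 0 of each side length makes one or both of the pieces
    vanish. *)
Lemma box_volume_split (R : realType) (d : nat) (i : 'I_d) (t : R)
    (a b : 'cV[R]_d) :
  box_volume a b =
  box_volume (set_coord i (Num.max (a i 0) t) a) b +
  box_volume a (set_coord i (Num.min (b i 0) t) b).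
Proof.
have volE (u w : 'cV[R]_d) : box_volume u w = Num.max 0 (w i 0 - u i 0) *
    \prod_(j | j != i) Num.max 0 (w j 0 - u j 0).
  by rewrite /box_volume (bigD1 i).
rewrite !volE !mxE eqxx.
pose side (j : 'I_d) := Num.max 0 (b j 0 - a j 0).
rewrite [X in _ = _ * X + _](eq_bigr side) => [|j /negbTE ji]; last first.
  by rewrite mxE ji.
rewrite [X in _ = _ + _ * X](eq_bigr side) => [|j /negbTE ji]; last first.
  by rewrite mxE ji.
rewrite -mulrDl; congr (_ * _).
by rewrite !maxEle minEle; repeat case: ifP; lra.
Qed.

(** Cutting each box of a cover of X along the hyperplane x_i = t yields
    covers of the two parts of X with the same total volume.  Both pieces are
    closed boxes, overlapping in the hyperplane, so that open and closed sides
    need not be distinguished. *)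
Lemma halfspace_measurable (R : realType) (d : nat) (i : 'I_d.+1) (t : R) :
  lebesgue_measurable [set x : 'cV[R]_d.+1 | t <= x i 0].
Proof.
apply: le_caratheodory_measurable => X /=.
apply: le_ereal_inf_tmp => _ [ab Xab <-].
under eq_eseriesr do rewrite (box_volume_split i t) EFinD.
rewrite nneseriesD; [|by move=> *; rewrite lee_fin box_volume_ge0..].
apply: leeD; apply: ereal_inf_lbound.
- exists (fun k => (set_coord i (Num.max ((ab k).1 i 0) t) (ab k).1, (ab k).2));
    last by [].
  move=> x [/Xab[k _ abx] /= tx]; exists k => // j /=; rewrite mxE.
  case: eqP => [->|_]; last exact: abx.
  by rewrite ge_max tx andbT; exact: abx.
- exists (fun k => ((ab k).1, set_coord i (Num.min ((ab k).2 i 0) t) (ab k).2));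
    last by [].
  move=> x [/Xab[k _ abx] /= /negP]; rewrite -ltNge => /ltW xt.
  exists k => // j /=; rewrite mxE; case: eqP => [->|_]; last exact: abx.
  by rewrite le_min xt andbT; exact: abx.
Qed.

(** * The colouring by residues of integer parts *)

Definition residue_cell (R : realType) (d m : nat) (c : {ffun 'I_d -> 'I_m}) :
    set 'cV[R]_d :=
  [set x : 'cV[R]_d | forall i,
    (Num.floor (x i 0)%R = (c i : nat)%:Z %[mod m%:Z])%Z].

(** Coordinate i lies in the right residue class when it lies in [z, z + 1[
    for some integer z congruent to c i; such a slab is the difference of two
    half-spaces. *)
Lemma residue_cell_measurable (R : realType) (d m : nat)
    (c : {ffun 'I_d.+1 -> 'I_m}) :
  lebesgue_measurable (@residue_cell R d.+1 m c).
Proof.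
pose mu : {outer_measure set 'cV[R]_d.+1 -> \bar R} := @lebesgue_outer R d.+1.
have mH i t : mu.-cara.-measurable [set x : 'cV[R]_d.+1 | t <= x i 0].
  exact: halfspace_measurable.
suff : mu.-cara.-measurable (residue_cell c) by [].
have -> : residue_cell c = \bigcap_(i in [set: 'I_d.+1])
    \bigcup_(z in [set z : int | (z = (c i : nat)%:Z %[mod m%:Z])%Z])
      ([set x : 'cV[R]_d.+1 | z%:~R <= x i 0] `\`
       [set x | (z + 1)%:~R <= x i 0]).
  apply/seteqP; split => x.
    move=> cx i _; exists (Num.floor (x i 0)); first exact: cx.
    by split; [exact: floor_le_tmp|apply/negP; rewrite -ltNge floorD1_gt].
  move=> cx i; have [z zc [/= zx /negP]] := cx i I; rewrite -ltNge => xz.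
  by rewrite (@floor_def _ _ z) ?zx.
apply: fin_bigcap_measurable => // i _; rewrite bigcup_mkcond.
apply: countable_bigcupT_measurable => // z.
case: ifP => _; last exact: measurable0.
by apply: measurableD; exact: mH.
Qed.

Lemma residue_colouring (R : realType) (d m : nat) :
  (0 < d)%N -> (0 < m)%N ->
  exists C : 'I_(m ^ d) -> set 'cV[R]_d,
    measurable_colouring C /\
    forall k, exists c : {ffun 'I_d -> 'I_m}, C k = residue_cell c.
Proof.
case: d m => // d [//|m] _ _.
have e : (m.+1 ^ d.+1 = #|{ffun 'I_d.+1 -> 'I_m.+1}|)%N.
  by rewrite card_ffun !card_ord.
exists (fun k => residue_cell (enum_val (cast_ord e k))).
split; last by move=> k; eexists.
split; last by move=> k; exact: residue_cell_measurable.
(* Residues modulo m.+1, read as elements of 'I_m.+1 and back. *)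
have modE (z : int) : (z %% m.+1%:Z)%Z = (inord `|(z %% m.+1%:Z)%Z| : 'I_m.+1).
  rewrite inordK ?gez0_abs ?modz_ge0//.
  by rewrite -ltz_nat gez0_abs ?modz_ge0 ?ltz_pmod.
have ordE (n : 'I_m.+1) : ((n : nat)%:Z %% m.+1%:Z)%Z = n.
  by rewrite modz_small//= ltz_nat ltn_ord.
split.
- apply/seteqP; split => // x _.
  pose c := [ffun i => inord `|(Num.floor (x i 0)%R %% m.+1%:Z)%Z| : 'I_m.+1].
  exists (cast_ord (esym e) (enum_rank c)) => //.
  by rewrite cast_ordKV enum_rankK => i; rewrite ffunE ordE -modE.
- move=> k l _ _ [x [kx lx]].
  apply/(@cast_ord_inj _ _ e)/enum_val_inj/ffunP => i.
  apply: val_inj; have := kx i; rewrite lx !ordE => -[]//.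
(* The cell of c contains the point with integer coordinates c i. *)
- move=> k _; exists (\col_i (enum_val (cast_ord e k) i)%:R) => i.
  by rewrite mxE -[_%:R]/((Posz _)%:~R) intrKfloor.
Qed.

(** Write the trace as s + Q m, where Q is an integer and s, the sum of the d
    remainders r i, satisfies |s| < d.  Were it equal to d, then
    Q m = d - s would lie strictly between 0 and 2 d <= m. *)
Lemma trace_edge_matrix_neq (R : realType) (d m : nat)
    (c : {ffun 'I_d -> 'I_m}) (v : 'I_d.+1 -> 'cV[R]_d) :
  (0 < d)%N -> (d.*2 <= m)%N -> (forall i, residue_cell c (v i)) ->
  \tr (edge_matrix v) <> d%:R.
Proof.
move=> d0 dm cv tr_d.
pose z i j := Num.floor (v j i 0).
have /choice[q qE] i : exists q : int, z i (lift ord0 i) - z i ord0 = q * m%:Z.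
  apply/dvdzP; rewrite -eqz_mod_dvd; apply/eqP.
  by rewrite /z cv cv.
pose r i := (v (lift ord0 i) - v ord0) i 0 - (q i)%:~R * m%:R.
have r_lt1 i : `|r i| < 1.
  have -> : r i = (v (lift ord0 i) i 0 - (z i (lift ord0 i))%:~R)
                - (v ord0 i 0 - (z i ord0)%:~R).
    rewrite /r -[m%:R]/(m%:Z%:~R) -intrM -qE intrB !mxE; lra.
  have := floor_itv (v ord0 i 0); have := floor_itv (v (lift ord0 i) i 0).
  rewrite -/(z i _) -/(z i _) !intrD => /andP[? ?] /andP[? ?].
  rewrite ltr_norml; apply/andP; split; lra.
have trE : d%:R = \sum_i r i + (\sum_i q i)%:~R * m%:R.
  rewrite -tr_d /mxtrace (raddf_sum (intmul 1)) mulr_suml -big_split/=.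
  by apply: eq_bigr => i _; rewrite mxE /r subrK.
have rd : `|\sum_i r i| < d%:R.
  apply: le_lt_trans (ler_norm_sum _ _ _) _.
  rewrite -[d in d%:R]card_ord -sum1_card natr_sum.
  apply: ltr_sum => //; apply/hasP.
  by exists (Ordinal d0); rewrite ?mem_index_enum.
move: rd trE; rewrite ltr_norml => /andP[rd1 rd2].
set s := \sum_i r i in rd1 rd2 *; set Q := \sum_i q i => trE.
have Qm : (Q * m%:Z)%:~R = Q%:~R * m%:R :> R by rewrite intrM.
have Q1 : (0 < Q * m%:Z).
  by rewrite -(ltr_int R) Qm; lra.
have Q2 : (Q * m%:Z < (d.*2)%:Z).
  by rewrite -(ltr_int R) Qm -[X in _ < X]/(d.*2%:R) -muln2 natrM; lra.
have Q0 : (0 < Q) by move: Q1; rewrite pmulr_lgt0// ltz_nat; lia.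
have : m%:Z <= Q * m%:Z by rewrite ler_peMl.
by rewrite leNgt (lt_le_trans Q2)// lez_nat.
Qed.

Theorem mainTheorem3 (R : realType) :
  (exists C : 'I_49 -> set 'cV[R]_2,
     measurable_colouring C /\
     forall k : 'I_49,
       [set \tr (edge_matrix v)
       | v in [set v : 'I_3 -> 'cV[R]_2
              | (forall i, C k (v i)) /\ affinely_independent v]]
       <> [set: R]) /\
  (forall d : nat, (2 <= d)%N ->
     exists (n : nat) (C : 'I_n -> set 'cV[R]_d),
       measurable_colouring C /\
       forall k : 'I_n,
         [set \tr (edge_matrix v)
         | v in [set v : 'I_d.+1 -> 'cV[R]_d | forall i, C k (v i)]]
         <> [set: R]).
Proof.
have avoid d m (c : {ffun 'I_d -> 'I_m}) (A : set ('I_d.+1 -> 'cV[R]_d)) :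
    (0 < d)%N -> (d.*2 <= m)%N ->
    (forall v, A v -> forall i, residue_cell c (v i)) ->
    [set \tr (edge_matrix v) | v in A] <> [set: R].
  move=> d0 dm Ac AT; have [v Av] : [set \tr (edge_matrix v) | v in A] d%:R.
    by rewrite AT.
  exact: (trace_edge_matrix_neq d0 dm (Ac v Av)).
split.
  have [C [mC cellC]] := @residue_colouring R 2 7 isT isT.
  exists C; split=> // k; have [c Ck] := cellC k.
  by apply: (avoid 2 7 c) => // v [Cv _]; rewrite -Ck.
move=> d d2; have d0 : (0 < d)%N := ltnW d2.
have [|C [mC cellC]] := @residue_colouring R d d.*2 d0.
  by rewrite double_gt0.
exists (d.*2 ^ d)%N, C; split=> // k; have [c Ck] := cellC k.
by apply: (avoid _ _ c) => // v Cv; rewrite -Ck.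
Qed.
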